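(* Let $a<b$ be real numbers, let $f:[a,b]\to\mathbb{R}$ be continuous, and let $c\in(a,b)$ be the unique root of $f$ in $[a,b]$. Suppose that $f$ is differentiable on $A=(a,c)\cup(c,b)$ with $f'(x)\ge -2$ for each $x\in A$. Suppose also that $f(x)>0$ for each $x\in[a,c)$ and $f(x)<0$ for each $x\in(c,b]$. For any $x_0\in[a,b]$ define, for each $n\ge 0$, $$x_{n+1}=x_n+\frac{f(x_n)}{2}.$$ Then the sequence $\{x_n\}$ converges to $c$.
   Context: A root of $f$ is a point $x$ of its domain with $f(x)=0$. The assertion that the recursively defined sequence converges includes that it is well defined, i.e. every $x_n$ lies in the domain $[a,b]$ of $f$. *)

(* Defs.v *)
From mathcomp Require Import all_boot all_order all_algebra.
From mathcomp Require Import all_classical all_reals all_analysis.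

Set Implicit Arguments.
Unset Strict Implicit.
Unset Printing Implicit Defensive.

Import Order.TTheory GRing.Theory Num.Theory.
Import numFieldNormedType.Exports.

Local Open Scope ring_scope.

(* A function [a, b] -> R is represented by a total f : R -> R, so this sequence
   is total as well; it is the intended one only as long as every term lies in
   [a, b], which therefore has to be asserted separately. *)
Fixpoint half_step_seq (R : realType) (f : R -> R) (x0 : R) (n : nat) : R :=
  if n is m.+1 then
    half_step_seq f x0 m + f (half_step_seq f x0 m) / 2
  else x0.

(* Main.v *)
(* On either side of c, the bound f' >= -2 and f(c) = 0 give, by the mean value
   theorem, |f(x)| <= 2 |c - x|: the step f(x)/2 points towards c and never
   overshoots it.  The sequence is therefore monotone and stays between x_0
   and c, and its limit is a root of f by continuity. *)

Require Import Defs.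
From mathcomp Require Import all_boot all_order all_algebra.
From mathcomp Require Import all_classical all_reals all_analysis.
From mathcomp Require Import lra.

Set Implicit Arguments.
Unset Strict Implicit.
Unset Printing Implicit Defensive.

Import Order.TTheory GRing.Theory Num.Theory.
Import numFieldNormedType.Exports.

Local Open Scope classical_set_scope.
Local Open Scope ring_scope.

Lemma derive1_ge_increment (R : realType) (f : R -> R) (k x y : R) :
  x <= y -> {within `[x, y], continuous f} ->
  (forall z, z \in `]x, y[ -> derivable f z 1) ->
  (forall z, z \in `]x, y[ -> k <= (f^`())%classic z) ->
  k * (y - x) <= f y - f x.
Proof.
rewrite le_eqVlt => /predU1P[->|xy] fc fd fk; first by rewrite !subrr mulr0.
have [|z zxy ->] := @MVT R f (f^`())%classic x y xy _ fc.
  by move=> z zxy; rewrite derive1E; apply/derivableP/fd.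
by rewrite ler_wpM2r ?subr_ge0 ?(ltW xy) ?fk.
Qed.

(** Consecutive terms share the limit [l], so the increments, which are half the values of [f], tend
    to 0. Closedness keeps [l] in [A], where continuity relative to [A] can be applied. *)
Lemma half_step_seq_lim_root (R : realType) (f : R -> R) (A : set R) (x0 l : R) :
  closed A -> {within A, continuous f} ->
  (forall n, A (half_step_seq f x0 n)) ->
  half_step_seq f x0 n @[n --> \oo] --> l -> A l /\ f l = 0.
Proof.
set u := half_step_seq f x0 => clA fc uA ul.
have Al : A l by apply: (closed_cvg _ clA _ _ ul); exact: nearW.
split=> //.
have ful : f (u n) @[n --> \oo] --> f l.
  apply: (@cvg_comp _ _ _ u f); last by move/subspace_continuousP : fc; exact.
  (* Continuity at [l] is only along the trace of its neighbourhoods on [A]; the sequence converges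
     along that finer filter because it never leaves [A]. *)
  move=> B /ul [N _ NB]; exists N => // n Nn; exact: NB (uA n).
have fu0 : f (u n) @[n --> \oo] --> (0 : R).
  have -> : (fun n => f (u n)) = (fun n => 2 * (u n.+1 - u n)).
    by apply/funext => n; rewrite /u /=; lra.
  rewrite -(mulr0 2) -(subrr l); apply: cvgMr; apply: cvgB => //.
  by rewrite (cvg_shiftS u).
exact: (cvg_unique _ ful fu0).
Qed.

Theorem corollary2p1 (R : realType) (a b : R) (hab : a < b)
  (f : R -> R) (hf : {within `[a, b], continuous f})
  (c : R) (hc : c \in `]a, b[)
  (hroot : f c = 0)
  (huniq : forall x : R, x \in `[a, b] -> f x = 0 -> x = c)
  (hder : forall x : R, (`]a, c[ `|` `]c, b[) x -> derivable f x 1)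
  (hder_ge : forall x : R, (`]a, c[ `|` `]c, b[) x -> - 2 <= (f^`())%classic x)
  (hpos : forall x : R, x \in `[a, c[ -> 0 < f x)
  (hneg : forall x : R, x \in `]c, b] -> f x < 0)
  (x0 : R) (hx0 : x0 \in `[a, b]) :
  (forall n : nat, half_step_seq f x0 n \in `[a, b]) /\
  (half_step_seq f x0 n @[n --> \oo] --> c).
Proof.
move: hc hx0; rewrite !in_itv/= => /andP[ac cb] /andP[ax0 x0b].
(* The limit need not be identified in advance: confinement to a subinterval and mere convergence
   suffice, since the limit is a root in [[a, b]] and [c] is the only one. *)
have sub_cvg p q : a <= p -> q <= b ->
    (forall n, half_step_seq f x0 n \in `[p, q]) ->
    cvgn (half_step_seq f x0) ->
    (forall n, half_step_seq f x0 n \in `[a, b]) /\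
    (half_step_seq f x0 n @[n --> \oo] --> c).
  move=> ap qb upq /cvg_ex[l ul].
  have uab n : half_step_seq f x0 n \in `[a, b].
    have := upq n; rewrite !in_itv/= => /andP[pu uq].
    by rewrite (le_trans ap pu) (le_trans uq qb).
  split=> //.
  have [lab fl0] := half_step_seq_lim_root (@itv_closed _ _ a b) hf uab ul.
  by rewrite -(huniq _ lab fl0).
have fW p q : a <= p -> q <= b -> {within `[p, q], continuous f}.
  move=> ap qb; apply: continuous_subspaceW hf => z /=.
  rewrite !in_itv/= => /andP[pz zq].
  by rewrite (le_trans ap pz) (le_trans zq qb).
(* The fixed point [x0 = c] falls under the left case. *)
have [x0c|cx0] := leP x0 c.
- have step x : a <= x <= c -> x <= x + f x / 2 <= c.
    move=> /andP[ax xc].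
    have fx0 : 0 <= f x.
      move: xc; rewrite le_eqVlt => /predU1P[->|xc]; first by rewrite hroot.
      by apply/ltW/hpos; rewrite in_itv/= ax.
    have inA z : z \in `]x, c[ -> (`]a, c[ `|` `]c, b[) z.
      by rewrite in_itv/= => /andP[xz zc]; left; rewrite /= in_itv/= (le_lt_trans ax).
    (* On [[x, c]] this reads [- 2 * (c - x) <= - f x], that is, [f x / 2 <= c - x]: no
       overshoot. *)
    have := @derive1_ge_increment R f (- 2) x c xc (fW _ _ ax (ltW cb))
      (fun z zx => hder z (inA z zx)) (fun z zx => hder_ge z (inA z zx)).
    by rewrite hroot; lra.
  have u_in n : a <= half_step_seq f x0 n <= c.
    elim: n => [|n IHn] /=; first by rewrite ax0.
    (* The bound by [c] comes from the step itself; the bound by [a] is inherited, as the step moves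
       right. *)
    have /andP[ux ->] := step _ IHn; move: IHn => /andP[/le_trans + _].
    by move=> /(_ _ ux) ->.
  apply: (sub_cvg a c (lexx _) (ltW cb)) => [n|]; first by rewrite in_itv/= u_in.
  apply: nondecreasing_is_cvgn.
    by apply/nondecreasing_seqP => n; case/andP: (step _ (u_in n)).
  by exists c => _ [n _ <-]; case/andP: (u_in n).
- have step x : c <= x <= b -> c <= x + f x / 2 <= x.
    move=> /andP[cx xb].
    have fx0 : f x <= 0.
      move: cx; rewrite le_eqVlt => /predU1P[<-|cx]; first by rewrite hroot.
      by apply/ltW/hneg; rewrite in_itv/= cx.
    have inA z : z \in `]c, x[ -> (`]a, c[ `|` `]c, b[) z.
      by rewrite in_itv/= => /andP[cz zx]; right; rewrite /= in_itv/= cz (lt_le_trans zx).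
    (* Here the root is the left endpoint, so the bound is [- 2 * (x - c) <= f x], that is,
       [c <= x + f x / 2]. *)
    have := @derive1_ge_increment R f (- 2) c x cx (fW _ _ (ltW ac) xb)
      (fun z zx => hder z (inA z zx)) (fun z zx => hder_ge z (inA z zx)).
    by rewrite hroot; lra.
  have u_in n : c <= half_step_seq f x0 n <= b.
    elim: n => [|n IHn] /=; first by rewrite (ltW cx0).
    by have /andP[-> /le_trans] := step _ IHn; apply; case/andP: IHn.
  apply: (sub_cvg c b (ltW ac) (lexx _)) => [n|]; first by rewrite in_itv/= u_in.
  apply: nonincreasing_is_cvgn.
    by apply/nonincreasing_seqP => n; case/andP: (step _ (u_in n)).
  by exists c => _ [n _ <-]; case/andP: (u_in n).
Qed.
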